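(* Let $p\ge 1$, $k\in\{0,\ldots,p\}$, and let $\Pi = (\{1,\ldots,k\},\{k+1,\ldots,p\})$. Let $s$ be a scalarizing function for $\Pi$ and let $S = \{s_w : w\in\mathbb{R}^p_>\}$ be the weighted scalarization induced by $W=\mathbb{R}^p_>$ and $s$, where $s_w:\mathbb{R}^p_>\to\mathbb{R}$, $s_w(y) = s(w_1 y_1,\ldots,w_p y_p)$. Suppose that for some $\bar y\in\mathbb{R}^p_>$ there are $q,q'\in\mathbb{R}^p_>$ such that every $y\in L(\bar y,s)$ satisfies $y_i\le q_i$ for $i=1,\ldots,k$ and $y_i\ge q'_i$ for $i=k+1,\ldots,p$. Define $$\beta := \inf_{\bar y \in \mathbb{R}^p_>} \ \sup \left\{\max \left\{ \frac{y^*_1}{\bar{y}_1}, \ldots, \frac{y^*_k}{\bar{y}_k}, \frac{\bar{y}_{k+1}}{y^*_{k+1}},\ldots,\frac{\bar{y}_{p}}{y^*_{p}} \right\}\ \middle|\ y^* \in L(\bar{y},s)\right\}.$$ Then, in each instance of each $p$-objective optimization problem of type $\Pi$, every optimal solution set for $S$ is a $(\beta+\varepsilon)$-approximation set for any $\varepsilon>0$. If the infimum is attained, i.e., if there exists $\bar y\in\mathbb{R}^p_>$ such that $$\beta = \sup \left\{\max \left\{ \frac{y^*_1}{\bar{y}_1}, \ldots, \frac{y^*_k}{\bar{y}_k}, \frac{\bar{y}_{k+1}}{y^*_{k+1}},\ldots,\frac{\bar{y}_{p}}{y^*_{p}} \right\}\ \middle|\ y^* \in L(\bar{y},s)\right\},$$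 then, in each instance of each $p$-objective optimization problem of type $\Pi$, every optimal solution set for $S$ is a $\beta$-approximation set.
   Context: $\mathbb{R}^p_> = \{y \in \mathbb{R}^p : y_i > 0 \text{ for } i=1,\ldots,p\}$. $\Pi = (\{1,\ldots,k\},\{k+1,\ldots,p\})$ means that objectives $1,\ldots,k$ are to be minimized and objectives $k+1,\ldots,p$ are to be maximized. For $y,y'\in\mathbb{R}^p$, $y <_\Pi y'$ means $y_i < y'_i$ for $i=1,\ldots,k$ and $y_i > y'_i$ for $i=k+1,\ldots,p$. A $p$-objective optimization problem of type $\Pi$ is a set of instances; each instance $(X,f)$ consists of a set $X$ of feasible solutions and a vector $f=(f_1,\ldots,f_p)$ of objective functions on $X$. Standing assumption: in every instance, $f(X)$ is a compact subset of $\mathbb{R}^p_>$. For $\alpha\ge 1$, $x\in X$ $\alpha$-approximates $x' \in X$ if $f_i(x) \le \alpha f_i(x')$ for $i=1,\ldots,k$ and $f_i(x) \ge \frac1\alpha f_i(x')$ for $i=k+1,\ldots,p$. A set $P\subseteq X$ is an $\alpha$-approximation set if every $x'\in X$ is $\alpha$-approximated by some $x\in P$. A scalarizing function for $\Pi$ is a continuous function $s:\mathbb{R}^p_>\to\mathbb{R}$ such that $y <_\Pi y'$ for $y,y'\in\mathbb{R}^p_>$ implies $s(y)<s(y')$. The level set of $s$ at $y'\in\mathbb{R}^p_>$ is $L(y',s)=\{y\in\mathbb{R}^p_> : s(y)=s(y')\}$. In an instance $(X,f)$, $x\in X$ is optimal for a scalarizing function $s$ if $s(f(x))\le s(f(x'))$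 for all $x'\in X$. A set $P \subseteq X$ is an optimal solution set for a set $S$ of scalarizing functions if for each $s\in S$ there is some $x\in P$ that is optimal for $s$. *)

(* Defs.v *)
From HB Require Import structures.
From mathcomp Require Import all_boot all_order all_algebra.
From mathcomp Require Import all_classical all_reals all_analysis.
Set Implicit Arguments.
Unset Strict Implicit.
Unset Printing Implicit Defensive.
Import Order.TTheory GRing.Theory Num.Theory.
Import numFieldNormedType.Exports.
Local Open Scope classical_set_scope.
Local Open Scope ring_scope.

(* Objectives are indexed from 0 by 'I_p.  The type
   Pi = ({1,...,k},{k+1,...,p}) is represented by the number k: objective i is
   minimized if (i < k)%N and maximized if (k <= i)%N.  Functions on the positive
   orthant are total functions on 'rV[R]_p of which only the values on
   [pos_orthant] are used. *)

Definition pos_orthant (R : realType) (p : nat) : set 'rV[R]_p :=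
  [set y | forall i : 'I_p, 0 < y 0 i].

Definition lt_Pi (R : realType) (p k : nat) (y y' : 'rV[R]_p) : Prop :=
  (forall i : 'I_p, (i < k)%N -> y 0 i < y' 0 i) /\
  (forall i : 'I_p, (k <= i)%N -> y 0 i > y' 0 i).

Record instance (R : realType) (p : nat) := Instance {
  feasible : Type;
  objective : feasible -> 'rV[R]_p;
  objective_compact : compact (range objective);
  objective_pos : range objective `<=` @pos_orthant R p }.

(* The type Pi only affects how the objectives are compared, hence k does not
   occur in the body. *)
Definition optimization_problem (R : realType) (p k : nat) : Type :=
  set (instance R p).

Definition approximates (R : realType) (p k : nat) (I : instance R p)
    (alpha : R) (x x' : feasible I) : Prop :=
  (forall i : 'I_p, (i < k)%N ->
     objective x 0 i <= alpha * objective x' 0 i) /\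
  (forall i : 'I_p, (k <= i)%N ->
     objective x 0 i >= alpha^-1 * objective x' 0 i).

(* Approximation is only defined for factors alpha >= 1; this is made part of
   being an approximation set. *)
Definition approximation_set (R : realType) (p k : nat) (I : instance R p)
    (alpha : R) (P : set (feasible I)) : Prop :=
  1 <= alpha /\
  forall x' : feasible I, exists2 x, P x & approximates k alpha x x'.

Definition scalarizing (R : realType) (p k : nat) (s : 'rV[R]_p -> R) : Prop :=
  {within @pos_orthant R p, continuous s} /\
  (forall y y', pos_orthant y -> pos_orthant y' -> lt_Pi k y y' -> s y < s y').

Definition level_set (R : realType) (p : nat) (y' : 'rV[R]_p)
    (s : 'rV[R]_p -> R) : set 'rV[R]_p :=
  [set y | pos_orthant y /\ s y = s y'].

Definition optimal (R : realType) (p : nat) (I : instance R p)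
    (s : 'rV[R]_p -> R) (x : feasible I) : Prop :=
  forall x' : feasible I, s (objective x) <= s (objective x').

Definition optimal_solution_set (R : realType) (p : nat) (I : instance R p)
    (S : set ('rV[R]_p -> R)) (P : set (feasible I)) : Prop :=
  forall s, S s -> exists2 x, P x & optimal s x.

Definition weighted (R : realType) (p : nat) (s : 'rV[R]_p -> R)
    (w : 'rV[R]_p) : 'rV[R]_p -> R :=
  fun y => s (\row_(i < p) (w 0 i * y 0 i)).

Definition weighted_scalarization (R : realType) (p : nat)
    (W : set 'rV[R]_p) (s : 'rV[R]_p -> R) : set ('rV[R]_p -> R) :=
  [set weighted s w | w in W].

Definition max_ratio (R : realType) (p k : nat) (ybar y : 'rV[R]_p) : \bar R :=
  \big[maxe/-oo%E]_(i < p)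
    (if (i < k)%N then y 0 i / ybar 0 i else ybar 0 i / y 0 i)%:E.

Definition sup_ratio (R : realType) (p k : nat) (s : 'rV[R]_p -> R)
    (ybar : 'rV[R]_p) : \bar R :=
  ereal_sup [set max_ratio k ybar y | y in level_set ybar s].

Definition beta (R : realType) (p k : nat) (s : 'rV[R]_p -> R) : \bar R :=
  ereal_inf [set sup_ratio k s ybar | ybar in @pos_orthant R p].

(* Main.v *)
(* Given x' and ybar, the weights w = ybar / f(x') move f(x') to ybar.  If x is
   optimal for s_w, then z = w f(x) satisfies s(z) <= s(ybar).  On a segment from
   z to a point worse than both z and ybar in every objective, the intermediate
   value theorem yields a point y of the level set of ybar which is no better
   than z in any objective, so the ratios z_i / ybar_i = f_i(x) / f_i(x') (or
   their inverses) are bounded by those of y. *)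
Require Import Defs.
From HB Require Import structures.
From mathcomp Require Import all_boot all_order all_algebra.
From mathcomp Require Import all_classical all_reals all_analysis.
From mathcomp Require Import lra.
Set Implicit Arguments.
Unset Strict Implicit.
Unset Printing Implicit Defensive.
Import Order.TTheory GRing.Theory Num.Theory.
Import numFieldNormedType.Exports.
Local Open Scope classical_set_scope.
Local Open Scope ring_scope.

Section Scalarization.
Variables (R : realType) (p k : nat).
Implicit Types (s : 'rV[R]_p -> R) (y z b ybar q : 'rV[R]_p).

(** Continuity of [s] is only given within the orthant; it transfers to the segment from [z] to [b]
    because the orthant is convex. *)
Lemma within_continuous_segment s z b :
  {within @pos_orthant R p, continuous s} -> pos_orthant z -> pos_orthant b ->
  {within `[0, 1], continuous (fun t : R => s (z + t *: (b - z)))}.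
Proof.
move=> /subspace_continuousP cs z0 b0; apply/subspace_continuousP => t t01.
have pos_seg u : `[0, 1]%classic u -> pos_orthant (z + u *: (b - z)).
  rewrite /= in_itv /= => /andP[u0 u1] i; rewrite !mxE.
  by have := z0 i; have := b0 i; nra.
have seg_cont : {for t, continuous (fun u : R => z + u *: (b - z))}.
  by apply: cvgD; [exact: cvg_cst | exact: cvgZr_tmp].
move=> A /(cs _ (pos_seg _ t01)) /seg_cont.
apply: (@filterS _ (nbhs t)) => u Au u01.
exact: (Au (pos_seg _ u01)).
Qed.

Lemma level_set_dominating s ybar z :
  scalarizing k s -> pos_orthant ybar -> pos_orthant z -> s z <= s ybar ->
  exists2 y, level_set ybar s y &
    (forall i : 'I_p, (i < k)%N -> z 0 i <= y 0 i) /\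
    (forall i : 'I_p, (k <= i)%N -> y 0 i <= z 0 i).
Proof.
move=> [cs s_lt] ybar0 z0 szy.
(* This is the point worse than both [z] and [ybar]: for positive [u] and [v], the sum [u + v]
   exceeds both, while [u * v / (u + v)] is below both and still positive, so [b] stays in the
   orthant. *)
pose b : 'rV[R]_p := \row_i (if (i < k)%N then z 0 i + ybar 0 i
                             else z 0 i * ybar 0 i / (z 0 i + ybar 0 i)).
have b0 : pos_orthant b.
  move=> i; rewrite mxE; have := z0 i; have := ybar0 i => ? ?.
  by case: ifP => _; rewrite ?divr_gt0 ?mulr_gt0 ?addr_gt0.
have b_lt_z (i : 'I_p) : (k <= i)%N -> b 0 i < z 0 i.
  rewrite mxE leqNgt => /negbTE ->; have := z0 i; have := ybar0 i => ? ?.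
  by rewrite ltr_pdivrMr ?addr_gt0// ltr_pM2l// ltrDr.
have lt_b : lt_Pi k ybar b.
  split=> i ik; have := z0 i; have := ybar0 i => ? ?; rewrite mxE.
    by rewrite ik ltrDr.
  rewrite ltnNge ik /= ltr_pdivrMr ?addr_gt0// mulrC ltr_pM2l//.
  by rewrite ltrDl.
have [t] : exists2 t : R, t \in `[0, 1] & s (z + t *: (b - z)) = s ybar.
  apply: (IVT (f := fun t => s (z + t *: (b - z)))) => //.
    exact: within_continuous_segment.
  rewrite scale0r addr0 scale1r subrKC ge_min le_max szy /=.
  by rewrite (ltW (s_lt _ _ ybar0 b0 lt_b)) orbT.
rewrite in_itv /= => /andP[t0 t1] st.
have segE (c : 'rV[R]_p) i :
    (z + t *: (c - z)) 0 i = z 0 i + t * (c 0 i - z 0 i).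
  by rewrite !mxE.
exists (z + t *: (b - z)).
  split=> // i; rewrite segE.
  by have := z0 i; have := b0 i; nra.
split=> i ik; rewrite segE.
  by rewrite mxE ik; have := ybar0 i; nra.
by have := b_lt_z i ik; nra.
Qed.

(** The point [ybar] lies in its own level set and all its ratios are 1. An index must exist, since
    the maximum over no objectives is [-oo]. *)
Lemma sup_ratio_ge1 s ybar : (1 <= p)%N -> pos_orthant ybar ->
  (1 <= sup_ratio k s ybar)%E.
Proof.
move=> p0 ybar0; pose i0 : 'I_p := Ordinal p0.
apply: (@le_trans _ _ (max_ratio k ybar ybar)); last first.
  by apply: ereal_sup_ubound; exists ybar.
apply: (bigmax_sup i0) => //.
by case: ifP => _; rewrite divff ?gt_eqF.
Qed.

Lemma beta_ge1 s : (1 <= p)%N -> (1 <= beta k s)%E.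
Proof.
by move=> p0; apply: le_ereal_inf_tmp => _ [ybar ybar0 <-];
  exact: sup_ratio_ge1.
Qed.

Lemma sup_ratio_lty s ybar q q' :
  pos_orthant ybar -> pos_orthant q' ->
  (forall y, level_set ybar s y ->
     (forall i : 'I_p, (i < k)%N -> y 0 i <= q 0 i) /\
     (forall i : 'I_p, (k <= i)%N -> y 0 i >= q' 0 i)) ->
  (sup_ratio k s ybar < +oo)%E.
Proof.
move=> ybar0 q'0 bnd.
pose m (i : 'I_p) := if (i < k)%N then q 0 i / ybar 0 i else ybar 0 i / q' 0 i.
(* A crude real bound above every [m i]; only finiteness matters here. *)
pose M : R := \sum_(i < p) `|m i|.
apply: (@le_lt_trans _ _ M%:E); last exact: ltry.
apply: ge_ereal_sup => _ [y [y0 sy] <-]; apply/bigmax_leP; split=> [|i _].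
  exact: leNye.
have [y_le y_ge] := bnd y (conj y0 sy).
rewrite lee_fin /M (bigD1 i)//=; apply: ler_wpDr; first exact: sumr_ge0.
apply: le_trans (ler_norm _); rewrite /m; case: ltnP => ik.
  by rewrite ler_pM2r ?invr_gt0// y_le.
by rewrite ler_pM2l// lef_pV2 ?posrE// y_ge.
Qed.

(** A single reference point [ybar] already yields a guarantee. Both approximation claims follow by
    choosing [ybar] nearly or exactly attaining the infimum. *)
Lemma approximation_set_sup_ratio (I : instance R p) (P : set (feasible I))
    s ybar (alpha : R) :
  (1 <= p)%N -> scalarizing k s -> pos_orthant ybar ->
  (sup_ratio k s ybar <= alpha%:E)%E ->
  optimal_solution_set (weighted_scalarization (@pos_orthant R p) s) P ->
  approximation_set k alpha P.
Proof.
move=> p0 hs ybar0 le_alpha optP.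
have alpha1 : 1 <= alpha.
  by rewrite -lee_fin; exact: le_trans (sup_ratio_ge1 s p0 ybar0) le_alpha.
split=> // x'.
have fpos (x : feasible I) : pos_orthant (objective x).
  by apply: (objective_pos (i := I)); exists x.
pose w : 'rV[R]_p := \row_i (ybar 0 i / objective x' 0 i).
have w0 : pos_orthant w by move=> i; rewrite mxE divr_gt0// fpos.
have [|x Px xopt] := optP (weighted s w); first by exists w.
exists x => //.
pose z : 'rV[R]_p := \row_i (w 0 i * objective x 0 i).
have z0 : pos_orthant z by move=> i; rewrite mxE mulr_gt0// fpos.
have szy : s z <= s ybar.
  suff -> : ybar = \row_i (w 0 i * objective x' 0 i) by exact: xopt.
  by apply/rowP => i; rewrite !mxE divfK// gt_eqF// fpos.
have [y Ly [z_le z_ge]] := level_set_dominating hs ybar0 z0 szy.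
have ratio_le (i : 'I_p) :
    (if (i < k)%N then y 0 i / ybar 0 i else ybar 0 i / y 0 i) <= alpha.
  rewrite -lee_fin; apply: le_trans le_alpha.
  apply: (@le_trans _ _ (max_ratio k ybar y)).
    exact: (bigmax_sup i).
  by apply: ereal_sup_ubound; exists y.
have zE i : z 0 i = ybar 0 i * (objective x 0 i / objective x' 0 i).
  by rewrite !mxE mulrAC mulrA.
split=> i ik; have := ratio_le i.
  rewrite ik ler_pdivrMr// => /(le_trans (z_le i ik)).
  by rewrite zE mulrC ler_pM2r// ler_pdivrMr// fpos.
rewrite ltnNge ik /= ler_pdivrMr; last by case: Ly.
(* As [alpha] is positive, [ybar <= alpha * y] becomes a lower bound on [y], which [z] inherits in a
   maximized objective. *)
rewrite -ler_pdivrMl ?(lt_le_trans ltr01)// => /le_trans/(_ (z_ge i ik)).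
by rewrite zE mulrC ler_pM2l// ler_pdivlMr// fpos.
Qed.

End Scalarization.

(** Since [beta] is an extended real, its finiteness is part of the conclusion; this ensures that
    [fine] returns its true value and not the default 0. *)
Theorem theorem5p3 (R : realType) (p k : nat) (hp : (1 <= p)%N)
    (hk : (k <= p)%N) (s : 'rV[R]_p -> R) (hs : scalarizing k s)
    (hbound : exists ybar q q' : 'rV[R]_p,
      [/\ pos_orthant ybar, pos_orthant q, pos_orthant q' &
        forall y, level_set ybar s y ->
          (forall i : 'I_p, (i < k)%N -> y 0 i <= q 0 i) /\
          (forall i : 'I_p, (k <= i)%N -> y 0 i >= q' 0 i)]) :
  [/\ beta k s \is a fin_num,
      forall (Q : optimization_problem R p k) (I : instance R p), Q I ->
        forall P : set (feasible I),
          optimal_solution_set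
            (weighted_scalarization (@pos_orthant R p) s) P ->
          forall eps : R, 0 < eps ->
            approximation_set k (fine (beta k s) + eps) P
    & (exists2 ybar, pos_orthant ybar & beta k s = sup_ratio k s ybar) ->
      forall (Q : optimization_problem R p k) (I : instance R p), Q I ->
        forall P : set (feasible I),
          optimal_solution_set
            (weighted_scalarization (@pos_orthant R p) s) P ->
          approximation_set k (fine (beta k s)) P].
Proof.
have beta1 := beta_ge1 k s hp.
have beta_fin : beta k s \is a fin_num.
  have [ybar [q [q' [ybar0 q0 q'0 bnd]]]] := hbound.
  rewrite ge0_fin_numE ?(le_trans _ beta1)//.
  apply: le_lt_trans (sup_ratio_lty ybar0 q'0 bnd).
  by apply: ereal_inf_lbound; exists ybar.
split=> // [Q I QI P optP eps eps0|[ybar ybar0 beta_eq] Q I QI P optP].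
  (* Finiteness of the infimum provides a [ybar] whose supremum is below [beta + eps]. *)
  have [_ [ybar ybar0 <-] lt_eps] := lb_ereal_inf_adherent eps0 beta_fin.
  apply: (approximation_set_sup_ratio hp hs ybar0 _ optP).
  by rewrite EFinD fineK// ltW.
apply: (approximation_set_sup_ratio hp hs ybar0 _ optP).
by rewrite fineK// beta_eq.
Qed.
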